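(* Let $H$ be a connected bipartite graph with no vertices of degree zero or one, and let $G=G(H)$ be the extension of $H$. Then the normalized volume of the flow polytope $\mathcal{F}_1(G)$ is equal to the number of matchings (including the empty matching) in the almost-degree-whiskered graph $W(H)$.
   Context: A bipartite graph $H$ with shores $S(H)$ and $T(H)$ is regarded as a directed acyclic graph with every edge directed from $S(H)$ to $T(H)$; since no vertex has degree $0$ or $1$, the sources are exactly the vertices of $S(H)$ and the sinks exactly the vertices of $T(H)$. The extension $G(H)$ is the directed acyclic multigraph obtained from $H$ by adding two new vertices $s$ and $t$, two parallel directed edges from $s$ to $i$ for each $i\in S(H)$, and two parallel directed edges from $j$ to $t$ for each $j\in T(H)$. For a directed acyclic (multi)graph $G$, a vertex is inner if it has both incoming and outgoing edges; the flow polytope $\mathcal{F}_1(G)\subseteq\mathbb{R}^{E(G)}$ is the set of functions $f:E(G)\to\mathbb{R}_{\ge 0}$ such that at every inner vertex the sum of $f$ over incoming edges equals the sum over outgoing edges, and the sum of $f$ over all edges leaving source vertices equals $1$. It is a lattice polytope; its normalized volume is $d!$ times its $d$-dimensional Euclidean volume measured with respect to the lattice $\mathbb{Z}^{E(G)}\cap\mathrm{aff}(\mathcal{F}_1(G))$, where $d=\dim\mathcal{F}_1(G)$. The almost-degree-whiskered graph $W(H)$ of a graph $H$ is obtained by attaching, to each vertex $v$ of $H$, $\deg_H(v)-1$ new pendant vertices, each adjacent only to $v$. *)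

(* Defs.v *)
From HB Require Import structures.
From mathcomp Require Import all_boot all_order all_algebra.
From mathcomp Require Import all_classical all_reals all_analysis.

Set Implicit Arguments.
Unset Strict Implicit.
Unset Printing Implicit Defensive.

Import Order.TTheory GRing.Theory Num.Theory.

Local Open Scope ring_scope.

Record sgraph := SGraph {
  vertex :> finType;
  adj : rel vertex;
  adj_sym : symmetric adj;
  adj_irrefl : irreflexive adj }.

Definition deg (H : sgraph) (v : H) : nat := #|[set u | adj v u]|.

(* The empty graph is not connected. *)
Definition connected_graph (H : sgraph) : Prop :=
  (0 < #|H|)%N /\ forall x y : H, connect (@adj H) x y.

Definition shores (H : sgraph) (S T : {set H}) : Prop :=
  [/\ (S :|: T)%SET = [set: H]%SET,
      [disjoint S & T] &
      forall x y : H, adj x y ->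
        (x \in S) && (y \in T) || (x \in T) && (y \in S)].

Definition edges (H : sgraph) : {set {set H}} :=
  [set [set p.1; p.2]%SET | p : H * H & adj p.1 p.2]%SET.

Definition matchings (H : sgraph) : {set {set {set H}}} :=
  [set M : {set {set H}} | (M \subset edges H) && finset.trivIset M]%SET.

(* Vertices of W(H): [inl v] is a vertex of H, [inr (Tagged _ k)] with tag v
   is the k-th pendant vertex attached to v. *)
Definition whiskered_vertex (H : sgraph) : finType :=
  (H + {v : H & 'I_(deg v).-1})%type.

Definition whiskered_adj (H : sgraph) : rel (whiskered_vertex H) :=
  fun x y => match x, y with
    | inl u, inl v => adj u v
    | inl u, inr q => tag q == u
    | inr p, inl v => tag p == v
    | inr _, inr _ => false
  end.

Lemma whiskered_adj_sym (H : sgraph) : symmetric (@whiskered_adj H).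
Proof. by move=> [u|p] [v|q] //=; exact: adj_sym. Qed.

Lemma whiskered_adj_irrefl (H : sgraph) : irreflexive (@whiskered_adj H).
Proof. by move=> [u|p] //=; exact: adj_irrefl. Qed.

Definition whiskered (H : sgraph) : sgraph :=
  SGraph (@whiskered_adj_sym H) (@whiskered_adj_irrefl H).

Record dmgraph := DMGraph {
  dvertex : finType;
  dedge : finType;
  src : dedge -> dvertex;
  tgt : dedge -> dvertex }.

Definition is_source (G : dmgraph) (v : dvertex G) : bool :=
  [forall e : dedge G, tgt e != v].

Definition inner (G : dmgraph) (v : dvertex G) : bool :=
  [exists e : dedge G, tgt e == v] && [exists e : dedge G, src e == v].

(* Vertices of G(H): [inl v] for v in H, s = [inr false], t = [inr true].
   Edges of G(H): the edges of H directed from S to T, the two copies of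
   s -> i for i in S, and the two copies of j -> t for j in T. *)
Definition extension (H : sgraph) (S T : {set H}) : dmgraph :=
  @DMGraph (H + bool)%type
    ({p : H * H | [&& p.1 \in S, p.2 \in T & adj p.1 p.2]}
       + {i : H | i \in S} * bool
       + {j : H | j \in T} * bool)%type
    (fun e => match e with
      | inl (inl p) => inl (val p).1
      | inl (inr _) => inr false
      | inr (j, _) => inl (val j)
      end)
    (fun e => match e with
      | inl (inl p) => inl (val p).2
      | inl (inr (i, _)) => inl (val i)
      | inr _ => inr true
      end).

Local Open Scope classical_set_scope.

Definition flow_polytope (R : realType) (G : dmgraph) :
    set {ffun dedge G -> R} :=
  [set f : {ffun dedge G -> R} | [/\ forall e, 0 <= f e,
      forall v : dvertex G, inner v ->
        \sum_(e | tgt e == v) f e = \sum_(e | src e == v) f e &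
      \sum_(e | is_source (src e)) f e = 1]].
Arguments flow_polytope : clear implicits.

(* The n-fold product of the Lebesgue measure, in the form of Tonelli's
   iterated integral: on Borel sets it is the n-dimensional Lebesgue measure. *)
Fixpoint lebesgue_tuple (R : realType) (n : nat) :
    set (n.-tuple R) -> \bar R :=
  match n return set (n.-tuple R) -> \bar R with
  | 0 => fun A => \d_([tuple] : 0.-tuple R) A
  | m.+1 => fun A => (\int[@lebesgue_measure R]_x
      lebesgue_tuple [set t : m.-tuple R | A (cons_tuple (x : R) t)])%E
  end.

Definition aff (R : realType) (V : lmodType R) (P : set V) : set V :=
  [set x | exists (n : nat) (c : 'I_n -> R) (p : 'I_n -> V),
    [/\ forall i, P (p i), \sum_(i < n) c i = 1 &
        x = \sum_(i < n) c i *: p i]].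

Definition integral_points (R : realType) (E : finType) : set {ffun E -> R} :=
  [set f | forall e, f e \is a Num.int].

Definition affine_param (R : realType) (V : lmodType R) (d : nat)
    (b : V) (w : 'I_d -> V) (t : d.-tuple R) : V :=
  b + \sum_(i < d) tnth t i *: w i.

(* [affine_param b w] is an affine isomorphism from R^d onto aff P carrying Z^d
   onto the lattice of integral points of aff P; in particular d = dim P. *)
Definition lattice_param (R : realType) (E : finType)
    (P : set {ffun E -> R}) (d : nat)
    (b : {ffun E -> R}) (w : 'I_d -> {ffun E -> R}) : Prop :=
  [/\ injective (affine_param b w),
      range (affine_param b w) = aff P &
      affine_param b w @` [set t | forall i, tnth t i \is a Num.int]
        = aff P `&` @integral_points R E].

(* The value does not depend on the parametrization: two of them differ by an
   affine unimodular transformation of R^d. *)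
Definition normalized_volume (R : realType) (E : finType)
    (P : set {ffun E -> R}) (v : \bar R) : Prop :=
  exists (d : nat) (b : {ffun E -> R}) (w : 'I_d -> {ffun E -> R}),
    lattice_param P b w /\
    v = (d`!%:R%:E * lebesgue_tuple (affine_param b w @^-1` P))%E.

(* Main.v *)
Require Import Defs.
From mathcomp Require Import all_boot all_order all_algebra.
From mathcomp Require Import ring lra zify.

Set Implicit Arguments.
Unset Strict Implicit.
Unset Printing Implicit Defensive.

(** A point of the flow polytope is a point x of the standard simplex on the
    edges of H together with, for each vertex v, a splitting of the throughput
    x(v) (the sum of x over the edges at v) between the two parallel edges at v.
    Hence the Euclidean volume is the integral over the simplex of the product
    of the x(v).  Expanding the product gives a sum over the functions c
    choosing an edge at every vertex, and the Dirichlet integral of the monomial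
    of c contributes, after normalization, the product over e of k_e(c)!, where
    k_e(c) is the number of endpoints of e that choose e.  As k_e(c) <= 2, that
    product counts the sets M of edges chosen by both endpoints; such an M is a
    matching of H, and every vertex v not covered by M has deg v free choices:
    no whisker, or one of its deg v - 1 whiskers. *)

(** * Matchings of the whiskered graph *)

Lemma subset_imset_preim (A B : finType) (f : A -> B) (N : {set B}) :
  N \subset f @: [set: A] -> f @: (f @^-1: N) = N.
Proof.
move=> sN; apply/setP => b; apply/imsetP/idP => [[a + ->]|bN].
  by rewrite inE.
by have /imsetP[a _ ba] := subsetP sN b bN; exists a => //; rewrite inE -ba.
Qed.

Section Combinatorics.
Variables (H : sgraph) (S T : {set H}).
Hypothesis hST : shores S T.
Hypothesis hdeg : forall v : H, 0 < deg v.

Definition darc := {p : H * H | [&& p.1 \in S, p.2 \in T & adj p.1 p.2]}.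
Definition incident (v : H) (e : darc) : bool :=
  ((val e).1 == v) || ((val e).2 == v).

Lemma arcS (e : darc) : (val e).1 \in S.
Proof. by case/and3P: (valP e). Qed.
Lemma arcT (e : darc) : (val e).2 \in T.
Proof. by case/and3P: (valP e). Qed.
Lemma arc_adj (e : darc) : adj (val e).1 (val e).2.
Proof. by case/and3P: (valP e). Qed.

Lemma shore_cover (v : H) : (v \in S) || (v \in T).
Proof.
by have [/setP/(_ v) + _ _] := hST; rewrite in_setU in_setT => ->.
Qed.
Lemma shore_disj (v : H) : v \in S -> v \in T -> False.
Proof. by case: hST => _ /disjointFr D _ /D ->. Qed.

Lemma arc_of_adj (u v : H) : adj u v ->
  exists2 e : darc, incident u e & incident v e /\
    [set u; v] = [set (val e).1; (val e).2].
Proof.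
move=> uv; have [_ _ /(_ u v uv)/orP[]/andP[uS vT]] := hST.
  have p : [&& (u, v).1 \in S, (u, v).2 \in T & adj (u, v).1 (u, v).2].
    by rewrite /= uS vT.
  by exists (Sub (u, v) p : darc); rewrite /incident /= eqxx ?orbT.
have p : [&& (v, u).1 \in S, (v, u).2 \in T & adj (v, u).1 (v, u).2].
  by rewrite /= uS vT adj_sym.
by exists (Sub (v, u) p : darc); rewrite /incident /= eqxx ?orbT // setUC.
Qed.

Lemma card_incident (v : H) : #|incident v| = deg v.
Proof.
(* [other e] is the endpoint of e opposite to v. It is injective on the arcs at v, because the shore
   of v fixes which component of the pair is v. *)
pose other (e : darc) := if (val e).1 == v then (val e).2 else (val e).1.
rewrite /deg -(card_in_imset (f := other) (D := incident v)).
  apply: eq_card => u; rewrite inE; apply/imsetP/idP => [[e ve ->]|vu].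
    rewrite /other; move: ve; rewrite unfold_in /incident.
    have ea := arc_adj e.
    case: eqP => [<- _ //|_ /= /eqP <-]; by rewrite adj_sym.
  have [e ve [ue Ee]] := arc_of_adj vu; exists e => //.
  move: ve ue; rewrite /other /incident.
  have nvu : v != u by apply: contraTneq vu => ->; rewrite adj_irrefl.
  case: eqP => [-> _|_ /= /eqP ->]; first by rewrite (negPf nvu) /= => /eqP.
  by rewrite (negPf nvu) orbF => /eqP.
move=> e f; rewrite !unfold_in /incident /other => ev fv Eo.
have eS := arcS e; have eT := arcT e; have fS := arcS f; have fT := arcT f.
apply: val_inj; move: ev fv Eo eS eT fS fT.
case: (val e) (val f) => [a b] [a' b'] /=.
case: eqP => [-> /= _|_ /= /eqP ->]; case: eqP => [-> /= _|_ /= /eqP ->] -> //.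
- by move=> vS _ _ vT; case: (shore_disj vS vT).
- by move=> _ vT vS _; case: (shore_disj vS vT).
Qed.

(** * Arc choices and the factorials of their fibers *)

Definition arc_choices : {set {ffun H -> darc}} :=
  [set c : {ffun H -> darc} | [forall v, incident v (c v)]].

Definition both (c : {ffun H -> darc}) : {set darc} :=
  [set e | (c (val e).1 == e) && (c (val e).2 == e)].

(** This makes [both c] a matching: two of its arcs at v would both be the one arc that v
    chooses. *)
Lemma both_incident c v e : e \in both c -> incident v e -> c v = e.
Proof.
by rewrite inE => /andP[/eqP c1 /eqP c2] /orP[/eqP <-|/eqP <-].
Qed.

(** Only the two endpoints of e can choose e, so the fiber has at most two elements, and its
    factorial differs from 1 only when both choose e. *)
Lemma fact_card_fiber c (e : darc) : c \in arc_choices ->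
  (#|[pred v | c v == e]|)`! = (if e \in both c then 2 else 1)%N.
Proof.
rewrite inE => /forallP cP.
have ne : (val e).1 != (val e).2.
  by apply: contraTneq (arc_adj e) => ->; rewrite adj_irrefl.
have sub : [pred v | c v == e] \subset [set (val e).1; (val e).2].
  apply/subsetP => v; rewrite !inE => /eqP cv; have := cP v.
  by rewrite cv /incident => /orP[]/eqP ->; rewrite eqxx ?orbT.
case: ifPn => [eb|eNb].
  rewrite (_ : #|_| = 2) //; rewrite -[RHS](_ : #|[set (val e).1; (val e).2]| = 2).
    apply: eq_card => v; apply/idP/idP; first by move/(subsetP sub).
    by move: eb; rewrite !inE => /andP[/eqP c1 /eqP c2] /orP[]/eqP ->; apply/eqP.
  by rewrite cards2 ne.
have : #|[pred v | c v == e]| < 2.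
  rewrite -[X in _ < X](_ : #|[set (val e).1; (val e).2]| = 2); last first.
    by rewrite cards2 ne.
  apply: proper_card; rewrite properE sub /=; apply: contra eNb => sub'.
  have P v : v \in [set (val e).1; (val e).2] -> c v == e by move/(subsetP sub').
  by rewrite inE !P // !inE eqxx ?orbT.
by case: #|_| => [|[|]].
Qed.

Definition choice_matchings : {set {ffun H -> darc} * {set darc}} :=
  [set x : {ffun H -> darc} * {set darc} | (x.1 \in arc_choices) && (x.2 \subset both x.1)].

(** For a fixed c the product of factorials is a power of 2 with exponent the size of [both c],
    which is the number of its subsets M. *)
Lemma card_choice_matchings : #|choice_matchings| =
  (\sum_(c in arc_choices) \prod_(e : darc) (#|[pred v | c v == e]|)`!)%N.
Proof.
have -> : #|choice_matchings| = (\sum_(c in arc_choices)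
    \sum_(M : {set darc} | M \subset both c) 1)%N.
  rewrite pair_big_dep /= sum1_card; apply: eq_card => x. by rewrite inE [RHS]unfold_in.
apply: eq_bigr => c cP; rewrite (eq_bigr _ (fun e _ => fact_card_fiber e cP)).
rewrite -big_mkcond /= prod_nat_const sum1_card -card_powerset.
by apply: eq_card => M; rewrite inE.
Qed.

(** * Edges of the whiskered graph, indexed by arcs and whiskers *)

Definition warc := (darc + {v : H & 'I_(deg v).-1})%type.
Definition warc_set (a : warc) : {set whiskered H} :=
  match a with
  | inl e => [set inl (val e).1; inl (val e).2]
  | inr q => [set inl (tag q); inr q]
  end.
Definition wincident (v : H) (a : warc) : bool :=
  match a with inl e => incident v e | inr q => tag q == v end.

Lemma warc_set_inl v a : (inl v \in warc_set a) = wincident v a.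
Proof.
case: a => [e|q]; rewrite !inE /= /incident.
  by rewrite ![inl v == _]eq_sym.
by rewrite orbF eq_sym.
Qed.

(** The endpoints of an arc determine it since disjoint shores leave a single orientation; a whisker
    is determined by its pendant vertex. *)
Lemma warc_set_inj : injective warc_set.
Proof.
move=> [e|q] [f|r] Eef.
- congr inl; apply: val_inj.
  have E v := etrans (esym (warc_set_inl v (inl e)))
     (etrans (congr1 (fun X : {set whiskered H} => inl v \in X) Eef) (warc_set_inl v (inl f))).
  have := E (val e).1; have := E (val e).2; rewrite /= /incident !eqxx orbT /=.
  have eS := arcS e; have eT := arcT e; have fS := arcS f; have fT := arcT f.
  move: eS eT fS fT => /=; case: (sval e) (sval f) => [a b] [a' b'] /= aS bT aS' bT'.
  move=> /esym/orP[/eqP Eb|/eqP <-]; first by case: (shore_disj aS'); rewrite Eb.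
  by move=> /esym/orP[/eqP <- //|/eqP Ea]; case: (shore_disj aS); rewrite -Ea.
- by have /setP/(_ (inr r)) := Eef; rewrite !inE eqxx.
- by have /setP/(_ (inr q)) := Eef; rewrite !inE eqxx.
- have /setP/(_ (inr q)) := Eef; rewrite !inE eqxx /= => /esym/eqP[].
  by move=> ->.
Qed.

Lemma edges_whiskered : edges (whiskered H) = warc_set @: [set: warc].
Proof.
apply/setP => X; apply/imsetP/imsetP => [[[x y]]|[[e|q] _ ->]].
- rewrite inE /=; case: x y => [u|p] [v|q] //= uv ->.
  + have [e _ [_ Ee]] := arc_of_adj uv; exists (inl e); rewrite ?in_setT //=.
    apply/setP => -[z|z]; rewrite !inE //=.
    by have /setP/(_ z) := Ee; rewrite !inE.
  + by exists (inr q); rewrite ?in_setT //= (eqP uv).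
  + by exists (inr p); rewrite ?in_setT //= (eqP uv) setUC.
- by exists (inl (val e).1, inl (val e).2) => //; rewrite inE /= arc_adj.
- by exists (inl (tag q), inr q) => //; rewrite inE /=.
Qed.

(** Conflicts are tested at the vertices of H only, because a pendant vertex lies on a single
    edge. *)
Definition warc_matchings : {set {set warc}} :=
  [set N : {set warc} | [forall v, forall a in N, forall b in N,
     wincident v a ==> wincident v b ==> (a == b)]].

Lemma warc_matchingsP (N : {set warc}) : reflect
  (forall v a b, a \in N -> b \in N -> wincident v a -> wincident v b -> a = b)
  (N \in warc_matchings).
Proof.
rewrite inE; apply: (iffP forallP) => [P v a b aN bN va vb|P v].
  have /forall_inP/(_ a aN)/forall_inP/(_ b bN) := P v.
  by rewrite va vb => /eqP.
apply/forall_inP => a aN; apply/forall_inP => b bN.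
by apply/implyP => va; apply/implyP => vb; apply/eqP/(P v).
Qed.

Lemma card_warc_matchings : #|matchings (whiskered H)| = #|warc_matchings|.
Proof.
rewrite -(card_imset _ (imset_inj warc_set_inj)); apply: eq_card => M.
rewrite inE edges_whiskered; apply/andP/imsetP => [[sM /trivIsetP tM]|[N /warc_matchingsP NP ->]].
  exists (warc_set @^-1: M); last by rewrite subset_imset_preim.
  apply/warc_matchingsP => v a b; rewrite !inE => aM bM va vb.
  apply: warc_set_inj; apply/eqP; apply: contraT => nab.
  have := tM _ _ aM bM nab; rewrite disjoints_subset => /subsetP/(_ (inl v)).
  by rewrite inE !warc_set_inl va vb => /(_ isT).
split; first exact/imsetS/subsetT.
apply/trivIsetP => _ _ /imsetP[a aN ->] /imsetP[b bN ->] nab.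
rewrite -setI_eq0; apply/eqP/setP => -[v|q]; rewrite !inE ?warc_set_inl.
  apply/negbTE/negP => /andP[va vb].
  by rewrite (NP v a b aN bN va vb) eqxx in nab.
case: a b {aN bN} nab => [e|p] [f|r] nab; rewrite !inE ?andbF //=.
apply/negbTE/negP => /andP[/eqP[qp] /eqP[qr]].
by rewrite -qp -qr eqxx in nab.
Qed.

(** * Bijection between choices with a marked matching and matchings of the whiskered graph *)

Definition arc_rank (v : H) (e : darc) : nat := index e (enum (incident v)).

(* At a vertex not covered by the matching x.2, rank 0 of the chosen edge encodes
   "no whisker" and rank k+1 encodes the k-th whisker. *)
Definition warcs_of (x : {ffun H -> darc} * {set darc}) : {set warc} :=
  [set a : warc | match a with
    | inl e => e \in x.2
    | inr q => (x.1 (tag q) \notin x.2) &&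
               (arc_rank (tag q) (x.1 (tag q)) == (tagged q).+1)
    end].

Lemma arc_rank_lt v e : incident v e -> arc_rank v e < deg v.
Proof. by move=> ve; rewrite -card_incident cardE index_mem mem_enum. Qed.

Lemma arc_rank_inj v e f : incident v e -> incident v f ->
  arc_rank v e = arc_rank v f -> e = f.
Proof.
move=> ve vf E; rewrite -[LHS](nth_index e (s := enum (incident v))) ?mem_enum //.
by rewrite -/(arc_rank v e) E nth_index ?mem_enum.
Qed.

Lemma arc_rank_surj v k : k < deg v -> exists2 e, incident v e & arc_rank v e = k.
Proof.
rewrite -card_incident cardE => kd.
have [e0 _] : exists e0 : darc, true.
  by case: (enum (incident v)) kd => // e ? _; exists e.
exists (nth e0 (enum (incident v)) k).
  by have := mem_nth e0 kd; rewrite mem_enum.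
by rewrite /arc_rank index_uniq ?enum_uniq.
Qed.

Lemma warcs_of_matching x : x \in choice_matchings -> warcs_of x \in warc_matchings.
Proof.
case: x => c M; rewrite inE /= => /andP[cP /subsetP sM].
apply/warc_matchingsP => v [e|[u i]] [f|[u' j]]; rewrite !inE /=.
- by move=> /sM eb /sM fb ve vf; rewrite -(both_incident eb ve) (both_incident fb vf).
- by move=> eM /andP[cNM _] ve /eqP vu; rewrite vu (both_incident (sM _ eM) ve) eM in cNM.
- by move=> /andP[cNM _] eM /eqP vu ve; rewrite vu (both_incident (sM _ eM) ve) eM in cNM.
- move=> /andP[_ /eqP ri] /andP[_ /eqP rj] /eqP uv /eqP uv'; subst u u'.
  by congr (inr (Tagged _ _)); apply: ord_inj; move: ri; rewrite rj => -[].
Qed.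

(** The set M is the arc part of the image. A vertex covered by M must choose the covering arc;
    elsewhere the whiskers reveal the rank of the choice. *)
Lemma warcs_of_inj : {in choice_matchings &, injective warcs_of}.
Proof.
move=> [c M] [c' M']; rewrite !inE /=.
move=> /andP[/forallP cP /subsetP sM] /andP[/forallP cP' /subsetP sM'] E.
have EM : M = M' by apply/setP => e; have /setP/(_ (inl e)) := E; rewrite !inE.
subst M'; congr pair; apply/ffunP => v.
case: (boolP (c v \in M)) => cM; first by rewrite (both_incident (sM' _ cM)).
case: (boolP (c' v \in M)) => cM'; first by rewrite (both_incident (sM _ cM')).
have Er k : k.+1 < deg v -> (arc_rank v (c v) == k.+1) = (arc_rank v (c' v) == k.+1).
  move=> kd; have kd' : k < (deg v).-1 by lia.
  have /setP/(_ (inr (Tagged (fun v => 'I_(deg v).-1) (Ordinal kd')))) := E.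
  by rewrite !inE /= cM cM'.
apply: (@arc_rank_inj v) => //.
(* Whiskers detect the positive ranks only; if one rank is 0, a positive value of the other would be
   detected, so both are 0. *)
have := arc_rank_lt (cP v); have := arc_rank_lt (cP' v).
case Ec : (arc_rank v (c v)) Er => [|k] Er; last first.
  by move=> _ kd; apply/esym/eqP; rewrite -Er.
case Ec' : (arc_rank v (c' v)) Er => [|k'] Er //.
by move=> /Er; rewrite eqxx.
Qed.

(** The choice at v is the arc of N covering v if there is one, else the arc whose rank encodes the
    whisker of N at v, else the arc of rank 0, which exists because v has positive degree. *)
Lemma warcs_of_surj N : N \in warc_matchings ->
  exists2 x, x \in choice_matchings & N = warcs_of x.
Proof.
move/warc_matchingsP => NP.
pose M := [set e : darc | inl e \in N].
have cE v : exists e, [&& incident v e,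
    [forall f, (f \in M) && incident v f ==> (e == f)] &
    [forall f, (f \in M) ==> ~~ incident v f] ==> (e \notin M) &&
    [forall i : 'I_(deg v).-1, (inr (Tagged (fun v => 'I_(deg v).-1) i) \in N)
       == (arc_rank v e == i.+1)]].
  case: (pickP [pred f | (f \in M) && incident v f]) => [e /andP[eM ve]|no].
    exists e; rewrite ve /=; apply/andP; split.
      apply/forallP => f; apply/implyP => /andP[fM vf]; apply/eqP.
      by rewrite !inE in eM fM; have [] := NP v _ _ eM fM ve vf.
    by apply/implyP => /forallP/(_ e); rewrite eM ve.
  have noM f : incident v f -> f \notin M.
    by move=> vf; have := no f; rewrite /= vf andbT => ->.
  have F : forall e, incident v e ->
     [forall f, (f \in M) && incident v f ==> (e == f)].
    by move=> e _; apply/forallP => f; have := no f => /= ->.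
  case: (pickP [pred i : 'I_(deg v).-1 | inr (Tagged (fun v => 'I_(deg v).-1) i) \in N]).
    move=> i /= iN; have [|e ve re] := @arc_rank_surj v i.+1.
      by have := ltn_ord i; lia.
    exists e; rewrite ve F //= noM //=; apply/implyP => _; apply/forallP => j.
    rewrite re eqSS; apply/eqP; apply/idP/eqP => [jN|/ord_inj <- //].
    have := NP v _ _ iN jN; rewrite /= !eqxx => /(_ isT isT) [].
    by move/eqP; rewrite eq_Tagged /= => /eqP ->.
  move=> noi; have [|e ve re] := @arc_rank_surj v 0; first exact: hdeg.
  exists e; rewrite ve F //= noM //=; apply/implyP => _; apply/forallP => j.
  by rewrite re; have := noi j => /= ->.
pose c := [ffun v => xchoose (cE v)].
have cP v := xchooseP (cE v).
have {}cP v : [&& incident v (c v),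
    [forall f, (f \in M) && incident v f ==> (c v == f)] &
    [forall f, (f \in M) ==> ~~ incident v f] ==> (c v \notin M) &&
    [forall i : 'I_(deg v).-1, (inr (Tagged (fun v => 'I_(deg v).-1) i) \in N)
       == (arc_rank v (c v) == i.+1)]] by rewrite ffunE; exact: cP.
have cI v : incident v (c v) by have /and3P[] := cP v.
have cM e v : e \in M -> incident v e -> c v = e.
  move=> eM ve; have /and3P[_ /forallP/(_ e) + _] := cP v.
  by rewrite eM ve => /eqP.
exists (c, M).
  rewrite !inE /=; apply/andP; split; first exact/forallP.
  apply/subsetP => e eM; rewrite inE !(cM e) ?eqxx // /incident eqxx ?orbT //.
apply/setP => -[e|[v i]]; rewrite !inE //=.
have /and3P[_ _ /implyP P] := cP v.
case: (boolP [forall f, (f \in M) ==> ~~ incident v f]) => [/P/andP[]|].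
  by rewrite inE => -> /forallP/(_ i)/eqP ->.
case/forallPn => f; rewrite negb_imply negbK => /andP[fM vf].
rewrite (cM f v fM vf); move: fM; rewrite inE => fM.
rewrite fM /=; apply/negbTE/negP => iN.
by have := NP v _ _ fM iN vf; rewrite /= eqxx => /(_ isT).
Qed.

Theorem card_matchings_whiskered : #|matchings (whiskered H)| =
  (\sum_(c in arc_choices) \prod_(e : darc) (#|[pred v | c v == e]|)`!)%N.
Proof.
rewrite card_warc_matchings -card_choice_matchings.
rewrite -(card_in_imset warcs_of_inj); apply: eq_card => N.
apply/idP/imsetP => [/warcs_of_surj //|[x xP ->]].
exact: warcs_of_matching.
Qed.
End Combinatorics.

From mathcomp Require Import all_classical all_reals all_analysis.

Import Order.TTheory GRing.Theory Num.Theory.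
Import numFieldNormedType.Exports.

Local Open Scope classical_set_scope.
Local Open Scope ring_scope.

(** * Iterated integrals over boxes and simplices *)

Section Analysis.
Variable R : realType.
Local Notation mu := (@lebesgue_measure R).

Lemma integral_horner (p q : {poly R}) (c : R) : 0 <= c -> q^`() = p ->
  (\int[mu]_(x in `[0%R, c]) (p.[x])%:E = (q.[c] - q.[0])%:E)%E.
Proof.
rewrite le_eqVlt => /predU1P[<- _|c0 qp].
  by rewrite set_itv1 integral_set1 subrr.
rewrite (@continuous_FTC2 _ (horner p) (horner q)) //.
- by apply: continuous_subspaceT => x; exact: continuous_horner.
- split.
  + by move=> x _; apply: derivable_horner.
  + by apply: cvg_at_right_filter; exact: continuous_horner.
  + by apply: cvg_at_left_filter; exact: continuous_horner.
- by move=> x _; rewrite -derivE qp.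
Qed.

(** The Beta integral over the segment from 0 to c, in polynomial form. Induction on a is
    integration by parts, trading a factor X for a factor c - X. *)
Lemma beta_antiderivative (c : R) (a b : nat) : exists2 q : {poly R},
  q^`() = 'X^a * (c%:P - 'X) ^+ b &
  q.[c] - q.[0] = (a`! * b`!)%:R / ((a + b).+1)`!%:R * c ^+ (a + b).+1.
Proof.
have deriv_pow n : ((c%:P - 'X) ^+ n.+1)^`() = - n.+1%:R *: (c%:P - 'X) ^+ n :> {poly R}.
  by rewrite deriv_exp derivB derivC derivX sub0r mulN1r mulNrn scaleNr scaler_nat.
have natn0 n : n.+1%:R != 0 :> R by rewrite pnatr_eq0.
elim: a b => [|a IH] b.
  exists (- (b.+1%:R^-1) *: (c%:P - 'X) ^+ b.+1).
    by rewrite derivZ deriv_pow scalerA mulrNN mulVf // scale1r expr0 mul1r.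
  rewrite !hornerE subrr subr0 expr0n /= mulr0 sub0r mulNr opprK.
  have b0 : b`!%:R != 0 :> R by rewrite pnatr_eq0 -lt0n fact_gt0.
  by rewrite factS natrM invfM mulrCA mulfV // mulr1.
have [q q1 q2] := IH b.+1.
(* Differentiating the product cancels the derivative of [a.+1 *: q] and leaves the wanted
   integrand; the product itself vanishes at 0 and at c. *)
exists ((b.+1%:R^-1) *: (a.+1%:R *: q - 'X^(a.+1) * (c%:P - 'X) ^+ b.+1)).
  rewrite derivZ derivB derivZ q1 derivM deriv_pow derivXn /=.
  rewrite mulrnAl scaler_nat opprD addrA subrr add0r scaleNr mulrN opprK.
  by rewrite -scalerAr scalerA mulVf // scale1r.
have expr0S n : 0 ^+ n.+1 = 0 :> R by rewrite expr0n.
set r := (X in _ = X); rewrite !hornerE subrr !expr0S mulr0 mul0r !subr0.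
rewrite -mulrBr -mulrBr q2 {}/r addSnnS.
have -> : (a.+1`! * b`!)%:R = a.+1%:R * a`!%:R * b`!%:R :> R.
  by rewrite factS !natrM.
have -> : (a`! * b.+1`!)%:R = a`!%:R * (b.+1%:R * b`!%:R) :> R.
  by rewrite factS !natrM.
set D := (_`!%:R)^-1. by field; rewrite addrC natr1.
Qed.

(** A form fitted to slice volumes: f lives on the whole line, and c may be negative, in which case
    the segment is empty. *)
Lemma integral_segment (f : R -> \bar R) (p q : {poly R}) (c : R) :
  q^`() = p ->
  (forall x, f x = if 0 <= x <= c then (p.[x])%:E else 0%E) ->
  (\int[mu]_x f x = if (0 <= c)%R then (q.[c] - q.[0])%:E else 0)%E.
Proof.
move=> qp fE; case: ifPn => c0.
  rewrite -(integral_horner c0 qp) [RHS]integral_mkcond.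
  apply: eq_integral => x _; rewrite fE patchE.
  by congr (if _ then _ else _); rewrite mem_setE in_itv.
apply: integral0_eq => x _; rewrite fE; case: ifP => // /andP[x0 xc].
by rewrite (le_trans x0 xc) in c0.
Qed.

(* Volumes are computed for sets of plain sequences: then the slice of a set at
   its first coordinate needs no cast. *)
Definition seq_volume (n : nat) (B : set (seq R)) : \bar R :=
  lebesgue_tuple [set t : n.-tuple R | B t].

Lemma seq_volumeS n B :
  (seq_volume n.+1 B = \int[mu]_x seq_volume n [set s | B (x :: s)])%E.
Proof. by []. Qed.

Lemma seq_volume_set0 n : seq_volume n set0 = 0%E.
Proof.
elim: n => [|n IH]; first by rewrite /seq_volume /= diracE memNset.
rewrite seq_volumeS; apply: integral0_eq => x _.
exact: IH.
Qed.

Lemma seq_volume_box (bs : seq R) : all (fun b => 0 <= b) bs ->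
  seq_volume (size bs)
    [set s | forall i, (i < size bs)%N -> 0 <= s`_i <= bs`_i]
  = (\prod_(b <- bs) b)%:E.
Proof.
elim: bs => [_|b bs IH /= /andP[b0 /IH{}IH]].
  by rewrite /seq_volume /= diracE big_nil mem_set.
rewrite seq_volumeS (@integral_segment _ (\prod_(y <- bs) y)%:P
  ((\prod_(y <- bs) y) *: 'X) b).
- by rewrite b0 !hornerE subr0 big_cons mulrC.
- by rewrite derivZ derivX alg_polyC.
move=> x; rewrite hornerC -IH; case: ifPn => xb.
  congr seq_volume; apply/seteqP; split=> s /= Hs => [i ib|[|i] ib] //.
    exact: (Hs i.+1).
  exact: Hs.
rewrite -[RHS](seq_volume_set0 (size bs)); congr seq_volume.
by apply/seteqP; split=> s //= /(_ 0 isT) /= xb'; rewrite xb' in xb.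
Qed.

(** The Dirichlet integral. The fibers of B over the simplex of size c have as volume a weighted sum
    of monomials in the m coordinates and the slack, whose exponent is [k j m]. Integrating out the
    first coordinate last, each inductive step is a Beta integral. *)
Lemma seq_volume_simplex (J : finType) (n m : nat) (B : set (seq R)) (c : R)
    (w : J -> R) (k : J -> nat -> nat) :
  (forall x : seq R, size x = m -> seq_volume n [set s | B (x ++ s)] =
     if all (fun y => 0 <= y) x && (\sum_(y <- x) y <= c) then
       (\sum_j w j * (\prod_(i < m) x`_i ^+ k j i)
          * (c - \sum_(y <- x) y) ^+ k j m)%:E
     else 0%E) ->
  seq_volume (m + n) B =
    if 0 <= c then
      (\sum_j w j * (\prod_(i < m.+1) (k j i)`!)%:R
         / ((m + \sum_(i < m.+1) k j i)`!)%:R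
         * c ^+ (m + \sum_(i < m.+1) k j i))%:E
    else 0%E.
Proof.
elim: m B c w k => [|m IH] B c w k HB.
  have := HB [::] erefl; rewrite /= big_nil subr0 add0n => ->.
  case: ifP => // _; congr EFin; apply: eq_bigr => j _.
  rewrite big_ord0 !big_ord1 add0n mulr1 -!mulrA; congr (_ * _).
  by rewrite mulVKf // pnatr_eq0 -lt0n fact_gt0.
(* By induction the slice at first coordinate x contributes [C j] times [x ^+ k j 0] times the power
   [N j] of c - x. *)
pose N j := (m + \sum_(i < m.+1) k j i.+1)%N.
pose C j := w j * (\prod_(i < m.+1) (k j i.+1)`!)%:R / (N j)`!%:R.
have /choice[q qP] : forall j, exists q : {poly R},
    q^`() = 'X^(k j 0) * (c%:P - 'X) ^+ N j /\
    q.[c] - q.[0] = ((k j 0)`! * (N j)`!)%:R / ((k j 0 + N j).+1)`!%:R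
                     * c ^+ (k j 0 + N j).+1.
  by move=> j; have [q ? ?] := beta_antiderivative c (k j 0) (N j); exists q.
rewrite addSn seq_volumeS (@integral_segment _
  (\sum_j C j *: ('X^(k j 0) * (c%:P - 'X) ^+ N j)) (\sum_j C j *: q j) c).
- case: ifP => // _; congr EFin.
  rewrite !horner_sum -sumrB; apply: eq_bigr => j _.
  have -> : (m.+1 + \sum_(i < m.+2) k j i = (k j 0 + N j).+1)%N.
    by rewrite big_ord_recl /= /N addSn addnCA.
  rewrite !hornerZ -mulrBr (qP j).2 big_ord_recl /= /C.
  under [in RHS]eq_bigr do rewrite /bump /= add1n.
  have N0 : (N j)`!%:R != 0 :> R by rewrite pnatr_eq0 -lt0n fact_gt0.
  by set D := ((_ + N j).+1`!%:R)^-1; set E := c ^+ _; rewrite !natrM; field.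
- by rewrite raddf_sum; apply: eq_bigr => j _; rewrite /= derivZ (qP j).1.
move=> x; case: (lerP 0 x) => x0 /=; last first.
  (* A slice at negative x has volume 0: this is the induction hypothesis with zero weights. *)
  rewrite (IH _ c (fun=> 0) k) => [|y ym].
    by rewrite big1 ?if_same // => j _; rewrite !mul0r.
  have := HB (x :: y) (congr1 S ym); rewrite /= leNgt x0 /= => ->.
  by case: ifP => // _; rewrite big1 // => j _; rewrite !mul0r.
(* Fixing x shrinks the simplex to size c - x, shifts the exponents, and moves the power of x into
   the weights. *)
rewrite (IH _ (c - x) (fun j => w j * x ^+ k j 0) (fun j i => k j i.+1)).
  rewrite subr_ge0; case: ifP => // _; congr EFin.
  rewrite horner_sum; apply: eq_bigr => j _; rewrite !hornerE /C /N.
  by rewrite /=; set D := (_`!%:R)^-1; set E := (c - x) ^+ _; ring.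
move=> y ym; have := HB (x :: y) (congr1 S ym); rewrite /= x0 big_cons /= => ->.
rewrite lerBrDl; case: ifP => // _; congr EFin; apply: eq_bigr => j _.
by rewrite big_ord_recl /= opprD !addrA !mulrA.
Qed.

End Analysis.

(** * The flow polytope of the extension *)

Lemma sum_pair_bool (V : nmodType) (I : finType) (i : I) (F : I * bool -> V) :
  \sum_(p | p.1 == i) F p = F (i, false) + F (i, true).
Proof.
rewrite (bigD1 (i, false)) ?eqxx //= (bigD1 (i, true)) /=.
  rewrite big_pred0 ?addr0 // => -[j b] /=; rewrite !xpair_eqE.
  by case: (j == i); case: b.
by rewrite xpair_eqE !eqxx.
Qed.

Section FlowPolytope.
Variables (R : realType) (H : sgraph) (S T : {set H}).
Hypothesis hST : shores S T.
Hypothesis hdeg : forall v : H, (0 < deg v)%N.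

Local Notation darc := (darc S T).
Local Notation flow := {ffun dedge (extension S T) -> R}.

Definition arc_edge (e : darc) : dedge (extension S T) := inl (inl e).
Definition in_edge (i : {i : H | i \in S}) (b : bool) :
  dedge (extension S T) := inl (inr (i, b)).
Definition out_edge (j : {j : H | j \in T}) (b : bool) :
  dedge (extension S T) := inr (j, b).

Definition throughput (x : darc -> R) (v : H) : R := \sum_(e | incident v e) x e.

(** The equations of the polytope without its inequalities; they turn out to cut out its affine
    hull. Conservation on either shore says that the two parallel edges share the throughput, and
    the unit leaving s is measured on the arcs of H. *)
Definition balanced (f : flow) : Prop :=
  [/\ forall i, f (in_edge i false) + f (in_edge i true)
        = throughput (f \o arc_edge) (val i),
      forall j, f (out_edge j false) + f (out_edge j true)
        = throughput (f \o arc_edge) (val j) &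
      \sum_e f (arc_edge e) = 1].

Lemma exists_incident v : exists e : darc, incident v e.
Proof.
have /card_gt0P[u] := hdeg v; rewrite inE => vu.
by have [e ve _] := arc_of_adj hST vu; exists e.
Qed.

Lemma incidentS v (e : darc) : v \in S -> incident v e = ((val e).1 == v).
Proof.
move=> vS; rewrite /incident; case: eqP => //= _; apply/negbTE/negP => /eqP Ev.
by apply: (shore_disj hST vS); rewrite -Ev arcT.
Qed.

Lemma incidentT v (e : darc) : v \in T -> incident v e = ((val e).2 == v).
Proof.
move=> vT; rewrite /incident orbC; case: eqP => //= _; apply/negbTE/negP => /eqP Ev.
by apply: (shore_disj hST _ vT); rewrite -Ev arcS.
Qed.

Lemma inner_inl (v : H) : inner (inl v : dvertex (extension S T)).
Proof.
have [e ve] := exists_incident v.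
apply/andP; split; apply/existsP; case/orP: (shore_cover hST v) => vST.
- by exists (in_edge (Sub v vST) false); apply/eqP.
- by exists (arc_edge e); move: ve; rewrite incidentT // => /eqP Ev; apply/eqP; congr inl.
- by exists (arc_edge e); move: ve; rewrite incidentS // => /eqP Ev; apply/eqP; congr inl.
- by exists (out_edge (Sub v vST) false); apply/eqP.
Qed.

Lemma inner_inr (b : bool) : ~~ inner (inr b : dvertex (extension S T)).
Proof.
apply/negP => /andP[/existsP[d hd] /existsP[d' hd']]; move: hd hd'.
by case: b; case: d => [[e|[i c]]|[j c]] //=; case: d' => [[e'|[i' c']]|[j' c']].
Qed.

Lemma source_inr : is_source (inr false : dvertex (extension S T)).
Proof. by apply/forallP => -[[e|[i c]]|[j c]]. Qed.

Lemma source_inl v : is_source (inl v : dvertex (extension S T)) = false.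
Proof.
apply/negbTE/negP => /forallP so; have /andP[/existsP[d hd] _] := inner_inl v.
by have := so d; rewrite hd.
Qed.

Lemma sum_tgt_in (f : flow) (i : {i : H | i \in S}) :
  \sum_(d : dedge (extension S T) | tgt d == inl (val i)) f d = f (in_edge i false) + f (in_edge i true).
Proof.
rewrite big_sumType big_sumType /= [X in _ + X]big_pred0 // addr0 big_pred0.
  rewrite add0r -(sum_pair_bool i (fun p => f (inl (inr p)))).
  by apply: eq_bigl => -[j b] /=.
move=> e /=; apply/negbTE/negP => /eqP[Ee].
by have := arcT e; rewrite /= Ee; exact: (shore_disj hST (valP i)).
Qed.

Lemma sum_tgt_out (f : flow) (j : {j : H | j \in T}) :
  \sum_(d : dedge (extension S T) | tgt d == inl (val j)) f d = throughput (f \o arc_edge) (val j).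
Proof.
rewrite big_sumType big_sumType /= [X in _ + X]big_pred0 // addr0.
rewrite [X in _ + X]big_pred0 ?addr0.
  by apply: eq_bigl => e; rewrite incidentT ?(valP j).
move=> [i b] /=; apply/negbTE/negP => /eqP[Ee].
by have := valP i; rewrite /= Ee => jS; exact: (shore_disj hST jS (valP j)).
Qed.

Lemma sum_src_in (f : flow) (i : {i : H | i \in S}) :
  \sum_(d : dedge (extension S T) | src d == inl (val i)) f d = throughput (f \o arc_edge) (val i).
Proof.
rewrite big_sumType big_sumType /= [X in _ + X + _]big_pred0 // addr0.
rewrite [X in _ + X]big_pred0 ?addr0.
  by apply: eq_bigl => e; rewrite incidentS ?(valP i).
move=> [j b] /=; apply/negbTE/negP => /eqP[Ee].
by have := valP j; rewrite /= Ee; exact: (shore_disj hST (valP i)).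
Qed.

Lemma sum_src_out (f : flow) (j : {j : H | j \in T}) :
  \sum_(d : dedge (extension S T) | src d == inl (val j)) f d = f (out_edge j false) + f (out_edge j true).
Proof.
rewrite big_sumType big_sumType /= [X in _ + X + _]big_pred0 // addr0 big_pred0.
  rewrite add0r -(sum_pair_bool j (fun p => f (inr p))).
  by apply: eq_bigl => -[i b] /=.
move=> e /=; apply/negbTE/negP => /eqP[Ee].
by have := arcS e; rewrite /= Ee => jS; exact: (shore_disj hST jS (valP j)).
Qed.

(** The only vertex with outgoing edges that is a source is s. What s sends to i in S leaves i along
    the arcs at i, and every arc has exactly one end in S. *)
Lemma sum_source (f : flow) :
  (forall i, f (in_edge i false) + f (in_edge i true)
     = throughput (f \o arc_edge) (val i)) ->
  \sum_(d : dedge (extension S T) | is_source (src d)) f d = \sum_e f (arc_edge e).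
Proof.
move=> fS; rewrite big_sumType big_sumType /= [X in X + _ + _]big_pred0; last first.
  by move=> e; rewrite source_inl.
rewrite [X in _ + X]big_pred0 ?addr0 ?add0r; last first.
  by move=> [j b]; rewrite source_inl.
pose h (e : darc) : {i : H | i \in S} := Sub (val e).1 (arcS e).
rewrite [RHS](partition_big h xpredT) //=.
rewrite (eq_bigl xpredT) => [|[i b]]; last by rewrite source_inr.
rewrite (partition_big (fun p : {i : H | i \in S} * bool => p.1) xpredT) //=.
apply: eq_bigr => i _; rewrite (sum_pair_bool i (fun p => f (inl (inr p)))).
rewrite fS /throughput; apply: eq_bigl => e; rewrite incidentS ?(valP i) //.
Qed.

Lemma flow_polytopeP (f : flow) : flow_polytope R (extension S T) f <->
  (forall d, 0 <= f d) /\ balanced f.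
Proof.
split=> [[f0 fC f1]|[f0 [fS fT f1]]].
  have fS i : f (in_edge i false) + f (in_edge i true)
      = throughput (f \o arc_edge) (val i).
    by rewrite -sum_tgt_in -sum_src_in fC ?inner_inl.
  split=> //; split=> // [j|].
    by rewrite -sum_tgt_out -sum_src_out fC ?inner_inl.
  by rewrite -sum_source.
split=> //; last by rewrite sum_source.
move=> [v _|b ib]; last by have := inner_inr b; rewrite ib.
case/orP: (shore_cover hST v) => vST.
  have := fS (Sub v vST); rewrite -sum_tgt_in -sum_src_in //.
by have := fT (Sub v vST); rewrite -sum_tgt_out -sum_src_out => <-.
Qed.

(* [a v] is the flow on the first of the two parallel edges at [v]. *)
Definition flow_of (x : darc -> R) (a : H -> R) : flow :=
  [ffun d => match d with
    | inl (inl e) => x e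
    | inl (inr (i, b)) =>
        if b then throughput x (val i) - a (val i) else a (val i)
    | inr (j, b) =>
        if b then throughput x (val j) - a (val j) else a (val j)
    end].

Lemma flow_of_arc x a e : flow_of x a (arc_edge e) = x e.
Proof. by rewrite ffunE. Qed.

Lemma throughput_flow_of x a v :
  throughput (flow_of x a \o arc_edge) v = throughput x v.
Proof. by apply: eq_bigr => e _; exact: flow_of_arc. Qed.

Lemma balanced_flow_of x a : \sum_e x e = 1 -> balanced (flow_of x a).
Proof.
move=> x1; split=> [i|j|].
- by rewrite throughput_flow_of !ffunE /= addrC subrK.
- by rewrite throughput_flow_of !ffunE /= addrC subrK.
- by rewrite -x1; apply: eq_bigr => e _; rewrite flow_of_arc.
Qed.

Lemma flow_of_ge0 x a : (forall d, 0 <= flow_of x a d) <->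
  (forall e, 0 <= x e) /\ (forall v, 0 <= a v <= throughput x v).
Proof.
split=> [f0|[x0 a0] [[e|[i b]]|[j b]]].
- split=> [e|v]; first by have := f0 (arc_edge e); rewrite flow_of_arc.
  case/orP: (shore_cover hST v) => vST.
    have := f0 (in_edge (Sub v vST) false); have := f0 (in_edge (Sub v vST) true).
    by rewrite !ffunE /= subr_ge0 => -> ->.
  have := f0 (out_edge (Sub v vST) false); have := f0 (out_edge (Sub v vST) true).
  by rewrite !ffunE /= subr_ge0 => -> ->.
- by rewrite ffunE.
- by rewrite ffunE; have /andP[] := a0 (val i); case: b; rewrite ?subr_ge0.
- by rewrite ffunE; have /andP[] := a0 (val j); case: b; rewrite ?subr_ge0.
Qed.

(** Recovers the parameter a of [flow_of]. Each vertex lies on one shore, so one [insub] succeeds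
    and the default 0 is never reached. *)
Definition split_value (f : flow) (v : H) : R :=
  oapp (fun i => f (in_edge i false))
    (oapp (fun j => f (out_edge j false)) 0 (insub v)) (insub v).

Lemma split_valueS f (i : {i : H | i \in S}) :
  split_value f (val i) = f (in_edge i false).
Proof. by rewrite /split_value valK. Qed.

Lemma split_valueT f (j : {j : H | j \in T}) :
  split_value f (val j) = f (out_edge j false).
Proof.
rewrite /split_value valK insubN //=.
by apply/negP => jS; exact: (shore_disj hST jS (valP j)).
Qed.

Lemma split_value_flow_of x a v : split_value (flow_of x a) v = a v.
Proof.
case/orP: (shore_cover hST v) => vST.
  by have := split_valueS (flow_of x a) (Sub v vST); rewrite /= => ->; rewrite ffunE.
by have := split_valueT (flow_of x a) (Sub v vST); rewrite /= => ->; rewrite ffunE.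
Qed.

Lemma flow_of_balanced f : balanced f ->
  f = flow_of (f \o arc_edge) (split_value f).
Proof.
move=> [fS fT _]; apply/ffunP => -[[e|[i b]]|[j b]]; rewrite ffunE //=.
  by rewrite split_valueS -fS; case: b => //; rewrite addrAC subrr add0r.
by rewrite split_valueT -fT; case: b => //; rewrite addrAC subrr add0r.
Qed.

(** [flow_of] is linear in the pair of its arguments; the separate base term matches the shape of
    [affine_param]. *)
Lemma flow_of_sum (I : finType) (k : I -> R) x0 a0 (x : I -> darc -> R) a :
  flow_of x0 a0 + \sum_i k i *: flow_of (x i) (a i) =
  flow_of (fun e => x0 e + \sum_i k i * x i e) (fun v => a0 v + \sum_i k i * a i v).
Proof.
have tE v : throughput (fun e => x0 e + \sum_i k i * x i e) v =
    throughput x0 v + \sum_i k i * throughput (x i) v.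
  rewrite /throughput big_split /=; congr (_ + _); rewrite exchange_big /=.
  by apply: eq_bigr => i _; rewrite mulr_sumr.
apply/ffunP => d; rewrite ffunE sum_ffunE.
under eq_bigr do rewrite ffunE.
case: d => [[e|[i b]]|[j b]]; rewrite !ffunE /=.
- by congr (_ + _); apply: eq_bigr => l _; rewrite ffunE.
- under eq_bigr do rewrite ffunE /=.
  case: b => //; rewrite tE opprD addrACA -sumrB; congr (_ + _).
  by apply: eq_bigr => l _; rewrite -mulrBr.
- under eq_bigr do rewrite ffunE /=.
  case: b => //; rewrite tE opprD addrACA -sumrB; congr (_ + _).
  by apply: eq_bigr => l _; rewrite -mulrBr.
Qed.

Lemma balanced_affine n (c : 'I_n -> R) (p : 'I_n -> flow) :
  (forall i, balanced (p i)) -> \sum_i c i = 1 ->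
  balanced (\sum_i c i *: p i).
Proof.
move=> pB c1.
(* A zero base term turns [flow_of_sum] into a statement about plain linear combinations. *)
have z : flow_of (fun=> 0) (fun=> 0) = 0.
  apply/ffunP => -[[e|[i b]]|[j b]]; rewrite !ffunE //=;
  by case: b => //; rewrite /throughput big1 ?subrr.
have -> : \sum_i c i *: p i = flow_of (fun e => 0 + \sum_i c i * p i (arc_edge e))
    (fun v => 0 + \sum_i c i * split_value (p i) v).
  rewrite -(flow_of_sum c (fun=> 0) (fun=> 0) (fun i => p i \o arc_edge)) z add0r.
  by apply: eq_bigr => i _; rewrite -flow_of_balanced.
apply: balanced_flow_of; under eq_bigr do rewrite add0r.
rewrite exchange_big /= -[RHS]c1; apply: eq_bigr => i _.
by rewrite -mulr_sumr; have [_ _ ->] := pB i; rewrite mulr1.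
Qed.

(** * Lattice parametrization of the affine hull *)

Variable m : nat.
Hypothesis hm : #|{: darc}| = m.+1.
Local Notation n := #|H|.

Lemma big_arc_rank (V : Type) (idx : V) (op : Monoid.com_law idx) (F : nat -> V) :
  \big[op/idx]_(e : darc) F (enum_rank e) = \big[op/idx]_(i < m.+1) F i.
Proof.
rewrite -hm [RHS](reindex (@enum_rank darc)) //=.
by exists enum_val => i _; rewrite ?enum_rankK ?enum_valK.
Qed.

(* The value on the last darc is determined by the total flow being 1. *)
Definition arc_coord (s : seq R) (i : nat) : R :=
  if (i < m)%N then s`_i else 1 - \sum_(j < m) s`_j.
Definition arc_value (s : seq R) (e : darc) : R := arc_coord s (enum_rank e).
(** The first m coordinates are arc flows; the splittings at the vertices follow, hence the offset
    m. *)
Definition vertex_value (s : seq R) (v : H) : R := s`_(m + enum_rank v).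
Definition flow_param (t : (m + n).-tuple R) : flow :=
  flow_of (arc_value t) (vertex_value t).

Lemma arc_rank_ltSm (e : darc) : (enum_rank e < m.+1)%N.
Proof. by rewrite -[X in (_ < X)%N]hm ltn_ord. Qed.

Lemma sum_arc_value s : \sum_e arc_value s e = 1.
Proof.
rewrite (big_arc_rank _ (arc_coord s)) big_ord_recr /= {2}/arc_coord ltnn.
rewrite (eq_bigr (fun j : 'I_m => s`_j)) => [|i _]; first by rewrite addrC subrK.
by rewrite /arc_coord ltn_ord.
Qed.

Definition flow_base : flow :=
  flow_of (fun e => (enum_rank e == m :> nat)%:R) (fun=> 0).
(** A direction with i < m shifts one unit from the last arc to arc i; any other one shifts a unit
    between the two parallel edges at a vertex. *)
Definition flow_dir (i : 'I_(m + n)) : flow :=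
  flow_of (fun e => if (i < m)%N then
             (enum_rank e == i :> nat)%:R - (enum_rank e == m :> nat)%:R else 0)
          (fun v => ((m + enum_rank v)%N == i)%:R).

Lemma affine_param_flow t : affine_param flow_base flow_dir t = flow_param t.
Proof.
rewrite /affine_param flow_of_sum /flow_param; congr flow_of; apply/funext.
  move=> e; rewrite big_split_ord /= [X in _ + (_ + X)]big1 ?addr0; last first.
    by move=> j _; rewrite ltnNge leq_addr mulr0.
  under eq_bigr do rewrite ltn_ord (tnth_nth 0) /=.
  rewrite /arc_value /arc_coord; have := arc_rank_ltSm e.
  case: (ltngtP (enum_rank e) m) => [rm _|//|-> _]; last 2 first.
  - by move=> mr; rewrite ltnS leqNgt mr.
  - rewrite -sumrN; congr (_ + _); apply: eq_bigr => i _.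
    by rewrite gtn_eqF // sub0r mulrN1.
  rewrite add0r (bigD1 (Ordinal rm)) //= eqxx subr0 mulr1 big1 ?addr0 // => i.
  by rewrite subr0 -val_eqE /= eq_sym => /negPf ->; rewrite mulr0.
move=> v; rewrite add0r (bigD1 (rshift m (enum_rank v))) //= eqxx mulr1.
rewrite (tnth_nth 0) big1 ?addr0 // => i.
by rewrite -val_eqE /= eq_sym => /negPf ->; rewrite mulr0.
Qed.

Definition arc_at (i : 'I_m) : darc :=
  enum_val (cast_ord (esym hm) (widen_ord (leqnSn m) i)).

Lemma rank_arc_at i : enum_rank (arc_at i) = i :> nat.
Proof. by rewrite enum_valK. Qed.

Definition flow_coord (f : flow) (i : 'I_(m + n)) : R :=
  match fintype.split i with
  | inl i => f (arc_edge (arc_at i))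
  | inr j => split_value f (enum_val j)
  end.

Lemma flow_paramK t : [tuple flow_coord (flow_param t) i | i < m + n] = t.
Proof.
apply: eq_from_tnth => i; rewrite tnth_mktuple /flow_coord (tnth_nth 0).
case: fintype.splitP => j ->.
  by rewrite flow_of_arc /arc_value rank_arc_at /arc_coord ltn_ord.
by rewrite split_value_flow_of /vertex_value enum_valK.
Qed.

Lemma flow_coordK f : balanced f ->
  flow_param [tuple flow_coord f i | i < m + n] = f.
Proof.
move=> fB; rewrite [RHS]flow_of_balanced // /flow_param.
set t := [tuple _ | _ < _].
have arcE e : (enum_rank e < m)%N -> arc_value t e = f (arc_edge e).
  move=> rm; rewrite /arc_value /arc_coord rm.
  rewrite -[nat_of_ord _]/(nat_of_ord (lshift n (Ordinal rm))) nth_mktuple.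
  rewrite /flow_coord (unsplitK (inl _)); congr (f (arc_edge _)).
  by apply: enum_rank_inj; apply: ord_inj; rewrite rank_arc_at.
congr flow_of; apply/funext.
  (* On the last arc the values agree because both totals are 1 and all other arcs agree. *)
  move=> e; have := arc_rank_ltSm e; rewrite ltnS leq_eqVlt => /predU1P[em|/arcE //].
  have [_ _] := fB; rewrite -(sum_arc_value t) (bigD1 e) //= [RHS](bigD1 e) //=.
  rewrite (eq_bigr (arc_value t)) => [/addIr //|e' ne].
  rewrite arcE // ltn_neqAle -ltnS arc_rank_ltSm andbT -em.
  by rewrite (inj_eq val_inj) (inj_eq enum_rank_inj).
move=> v; rewrite /vertex_value.
rewrite -[(m + enum_rank v)%N]/(nat_of_ord (rshift m (enum_rank v))) nth_mktuple.
by rewrite /flow_coord (unsplitK (inr _)) enum_rankK.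
Qed.

Lemma balanced_flow_param t : balanced (flow_param t).
Proof. by apply: balanced_flow_of; exact: sum_arc_value. Qed.

(** The parametrization and its inverse both have integer coefficients, so they match the integral
    points on the two sides. *)
Lemma flow_param_int t : (forall i, tnth t i \is a Num.int) ->
  forall d, flow_param t d \is a Num.int.
Proof.
move=> tI; have nI i : t`_i \is a Num.int.
  case: (ltnP i (m + n)) => im; last by rewrite nth_default ?size_tuple.
  by have := tI (Ordinal im); rewrite (tnth_nth 0).
have aI e : arc_value t e \is a Num.int.
  by rewrite /arc_value /arc_coord; case: ifP => // _; rewrite rpredB ?rpred1 ?rpred_sum.
have thI v : throughput (arc_value t) v \is a Num.int by exact: rpred_sum.
move=> [[e|[i b]]|[j b]]; rewrite ffunE //=;
by case: b; rewrite ?rpredB //; exact: nI.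
Qed.

Lemma flow_coord_int (f : flow) i : (forall d, f d \is a Num.int) ->
  flow_coord f i \is a Num.int.
Proof.
move=> fI; rewrite /flow_coord; case: fintype.split => // j.
by rewrite /split_value; case: insub => [?|]; case: insub => [?|] //=; exact: int_num0.
Qed.

Local Notation P := (flow_polytope R (extension S T)).

(* Some point of the polytope has all coordinates bounded below by d > 0, so a
   balanced f is reached by stretching a short segment of the polytope. *)
Lemma balanced_aff f : balanced f -> aff P f.
Proof.
move=> fB; pose M : R := m.+1%:R; have M0 : 0 < M by rewrite ltr0n.
have [u u0 uM] : exists2 u : R, 0 < u & u * M = 1.
  by exists M^-1; rewrite ?invr_gt0 ?mulVf ?gt_eqF.
pose x0 (_ : darc) := u.
(* The interior point: equal flow u on all arcs and even splittings. Every vertex has an arc, so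
   each throughput is at least u and each coordinate at least u / 2. *)
pose f0 := flow_of x0 (fun v => throughput x0 v / 2).
have [d d0 dE] : exists2 d : R, 0 < d & d = u / 2 by exists (u / 2); rewrite ?divr_gt0.
have f0B : balanced f0.
  apply: balanced_flow_of; by rewrite sumr_const hm -mulr_natr.
have thM v : u <= throughput x0 v.
  have [e ve] := exists_incident v; rewrite /throughput (bigD1 e) //= lerDl.
  by apply: sumr_ge0 => ? _; rewrite ltW.
have f0d e : d <= f0 e.
  case: e => [[e|[i b]]|[j b]]; rewrite ffunE /=; first by rewrite /x0; lra.
    by have := thM (val i); case: b => /=; lra.
  by have := thM (val j); case: b => /=; lra.
(* A bounds every deviation of f from f0, and the 1 keeps it positive; moving by [d / A] towards f
   lowers no coordinate by more than d. *)
pose A := 1 + \sum_e `|f e - f0 e|.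
have A0 : 0 < A by rewrite ltr_pwDl // sumr_ge0.
pose ep := d / A; have ep0 : 0 < ep by rewrite divr_gt0.
pose c1 k (i : 'I_2) : R := if i == ord0 then k else 1 - k.
pose p1 g (i : 'I_2) : flow := if i == ord0 then g else f0.
have sum2 k g : \sum_i c1 k i *: p1 g i = k *: g + (1 - k) *: f0.
  by rewrite big_ord_recl big_ord1.
have c1E k : \sum_i c1 k i = 1 by rewrite big_ord_recl big_ord1 /c1 /= addrC subrK.
pose g := ep *: f + (1 - ep) *: f0.
have gB : balanced g.
  rewrite /g -sum2; apply: balanced_affine (c1E _) => i.
  by rewrite /p1; case: ifP.
have f0P : P f0.
  by apply/flow_polytopeP; split=> // e; rewrite (le_trans (ltW d0)).
have gP : P g.
  apply/flow_polytopeP; split=> // e.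
  rewrite ffunE [X in X + _]ffunE [X in _ + X]ffunE.
  have ef : `|f e - f0 e| <= A.
    rewrite /A (bigD1 e) //= addrCA lerDl addr_ge0 // sumr_ge0 //.
  have : ep * `|f e - f0 e| <= d.
    rewrite /ep mulrAC ler_pdivrMr // ler_wpM2l // ltW //.
  have := f0d e; have := ler_norm (- (f e - f0 e)); rewrite normrN => h1 h2 h3.
  have h4 : ep * - (f e - f0 e) <= ep * `|f e - f0 e| by rewrite ler_wpM2l // ltW.
  have -> : ep *: f e + (1 - ep) *: f0 e = f0 e - ep * - (f e - f0 e).
    by rewrite -![_ *: _]/(_ * _); ring.
  by rewrite subr_ge0 (le_trans h4) // (le_trans h3).
(* Solving the definition of g for f writes f as an affine combination of g and f0. *)
exists 2, (c1 ep^-1), (p1 g); split=> // [i|]; first by rewrite /p1; case: ifP.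
have epV : ep^-1 * ep = 1 by rewrite mulVf ?gt_eqF.
rewrite sum2 /g scalerDr (scalerA ep^-1 ep f) epV scale1r.
rewrite (scalerA ep^-1 (1 - ep) f0) -addrA -scalerDl.
by rewrite mulrBr mulr1 epV addrA subrK subrr scale0r addr0.
Qed.

Lemma aff_flow_polytope : aff P = range flow_param.
Proof.
apply/seteqP; split=> [f [k [c [p [pP c1 ->]]]]|_ [t _ <-]].
  have sB : balanced (\sum_i c i *: p i).
    by apply: balanced_affine => // i; have /flow_polytopeP[] := pP i.
  by exists [tuple flow_coord (\sum_i c i *: p i) i | i < m + n]; rewrite ?flow_coordK.
exact/balanced_aff/balanced_flow_param.
Qed.

Lemma lattice_param_flow : lattice_param P flow_base flow_dir.
Proof.
have E : affine_param flow_base flow_dir = flow_param.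
  by apply/funext => t; exact: affine_param_flow.
rewrite /lattice_param E aff_flow_polytope; split=> //.
  by move=> t t' tt'; rewrite -(flow_paramK t) tt' flow_paramK.
apply/seteqP; split=> [_ [t tI <-]|_ [[t _ <-] fI]].
  by split; [exists t|exact: flow_param_int].
exists t => //= i; rewrite -(flow_paramK t) tnth_mktuple.
exact: flow_coord_int.
Qed.

End FlowPolytope.

(** * The volume *)

Section Volume.
Variables (R : realType) (H : sgraph) (S T : {set H}).
Hypothesis hST : shores S T.
Hypothesis hdeg : forall v : H, (0 < deg v)%N.
Variable m : nat.
Hypothesis hm : #|{: darc S T}| = m.+1.
Local Notation darc := (darc S T).
Local Notation n := #|H|.
Local Notation P := (flow_polytope R (extension S T)).
Local Notation arc_value := (@arc_value R H S T m).
Local Notation arc_coord := (@arc_coord R m).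
Local Notation vertex_value := (@vertex_value R H m).

Definition flow_region : set (seq R) :=
  [set s | (forall e, 0 <= arc_value s e) /\
     (forall v, 0 <= vertex_value s v <= throughput (arc_value s) v)].

Lemma lebesgue_flow_polytope :
  lebesgue_tuple (affine_param (flow_base R S T m) (@flow_dir R H S T m) @^-1` P)
    = seq_volume (m + n) flow_region.
Proof.
congr lebesgue_tuple; apply/funext => t /=; rewrite affine_param_flow //.
apply/propext; split.
  by move/(flow_polytopeP hST hdeg) => [/(flow_of_ge0 hST)].
move=> tP; apply/(flow_polytopeP hST hdeg); split.
  exact/(flow_of_ge0 hST).
exact: balanced_flow_param.
Qed.

(** * Expansion of the product of throughputs, and the slices of the region *)

Definition fiber_card (c : {ffun H -> darc}) (i : nat) : nat :=
  #|[pred v | enum_rank (c v) == i :> nat]|.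

Lemma fiber_card_rank c e : fiber_card c (enum_rank e) = #|[pred v | c v == e]|.
Proof.
by apply: eq_card => v; rewrite !inE (inj_eq val_inj) (inj_eq enum_rank_inj).
Qed.

(** All monomials have the same degree, so the Dirichlet integrals share the denominator
    [(m + n)!]. *)
Lemma sum_fiber_card c : (\sum_(i < m.+1) fiber_card c i = n)%N.
Proof.
rewrite -(big_arc_rank hm) /=.
rewrite -sum1_card (partition_big c xpredT) //=; apply: eq_bigr => e _.
by rewrite fiber_card_rank sum1_card.
Qed.

(** Distributivity gives a sum over all functions from vertices to arcs; the indicator of
    [arc_choices] becomes the weight in the Dirichlet integral. *)
Lemma prod_throughput s : \prod_v throughput (arc_value s) v =
  \sum_(c : {ffun H -> darc}) (c \in arc_choices S T)%:R *
     \prod_(i < m.+1) arc_coord s i ^+ fiber_card c i.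
Proof.
under eq_bigr do rewrite /throughput big_mkcond.
rewrite bigA_distr_bigA; apply: eq_bigr => c _; rewrite inE.
case: forallP => [cP|/forallP/forallPn[v cv]]; last first.
  by rewrite mul0r (bigD1 v) //= (negPf cv) mul0r.
rewrite mul1r (eq_bigr (fun v => arc_value s (c v))) => [|v _]; last by rewrite cP.
rewrite (partition_big c xpredT) //=.
rewrite -(big_arc_rank hm _ (fun i => arc_coord s i ^+ fiber_card c i)).
apply: eq_bigr => e _; rewrite fiber_card_rank.
rewrite (eq_bigr (fun=> arc_value s e)) => [|v /eqP -> //].
by rewrite prodr_const.
Qed.

Lemma arc_coord_cat x s i : size x = m -> arc_coord (x ++ s) i = arc_coord x i.
Proof.
move=> xm; rewrite /arc_coord nth_cat xm; case: ifP => [-> //|_]; congr (_ - _).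
by apply: eq_bigr => j _; rewrite nth_cat xm ltn_ord.
Qed.

Lemma arc_value_ge0 x : size x = m ->
  (forall e, 0 <= arc_value x e) <->
  all (fun y => 0 <= y) x && (\sum_(y <- x) y <= 1).
Proof.
move=> xm; have -> : \sum_(y <- x) y = \sum_(j < m) x`_j.
  by rewrite (big_nth 0) xm big_mkord.
split=> [x0|/andP[/(all_nthP 0) x0 x1] e]; last first.
  by rewrite /arc_value /arc_coord; case: ifP => [im|_]; rewrite ?x0 ?xm ?subr_ge0.
have {}x0 i : (i < m.+1)%N -> 0 <= arc_coord x i.
  rewrite -hm => im; have := x0 (enum_val (Ordinal im)).
  by rewrite /arc_value enum_valK.
apply/andP; split.
  apply/(all_nthP 0) => i; rewrite xm => im.
  by have := x0 i (ltnW im); rewrite /arc_coord im.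
by have := x0 m (ltnSn m); rewrite /arc_coord ltnn subr_ge0.
Qed.

(** Once the arc flows are fixed, the splittings vary independently, and the slice is a box with the
    throughputs as side lengths. *)
Lemma flow_region_slice x : size x = m ->
  seq_volume n [set s | flow_region (x ++ s)] =
  if all (fun y => 0 <= y) x && (\sum_(y <- x) y <= 1) then
    (\prod_v throughput (arc_value x) v)%:E
  else 0%E.
Proof.
move=> xm.
have vE s e : arc_value (x ++ s) e = arc_value x e by exact: arc_coord_cat.
have tE s v : throughput (arc_value (x ++ s)) v = throughput (arc_value x) v.
  by apply: eq_bigr => e _; exact: vE.
case: ifPn => xP; last first.
  rewrite -[RHS](seq_volume_set0 R n); congr seq_volume.
  apply/seteqP; split=> s //= [s0 _]; move/negP: xP; apply.
  by apply/(arc_value_ge0 xm) => e; rewrite -(vE s).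
have {}xP := (arc_value_ge0 xm).2 xP.
pose bs := [seq throughput (arc_value x) v | v <- enum H].
have bsn : size bs = n by rewrite size_map -cardE.
have bs0 : all (fun b => 0 <= b) bs.
  by apply/allP => _ /mapP[v _ ->]; exact: sumr_ge0.
have -> : \prod_v throughput (arc_value x) v = \prod_(b <- bs) b.
  by rewrite big_map big_enum.
have bsE v : bs`_(enum_rank v) = throughput (arc_value x) v.
  rewrite (nth_map v) ?nth_enum_rank //.
  by rewrite -cardE ltn_ord.
rewrite -seq_volume_box // bsn; congr seq_volume.
apply/seteqP; split=> s /= => [[_ sP] i im|sP].
  have := sP (enum_val (Ordinal im)).
  rewrite tE -bsE /vertex_value enum_valK /= nth_cat xm.
  by rewrite ltnNge leq_addr /= addKn.
split=> [e|v]; first by rewrite vE.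
have := sP (enum_rank v) (ltn_ord _); rewrite bsE tE /vertex_value nth_cat xm.
by rewrite ltnNge leq_addr /= addKn.
Qed.

Lemma volume_flow_region : seq_volume (m + n) flow_region =
  (#|matchings (whiskered H)|%:R / (m + n)`!%:R)%:E.
Proof.
rewrite (@seq_volume_simplex R _ n m _ 1
  (fun c => (c \in arc_choices S T)%:R) fiber_card) ?ler01.
  rewrite (card_matchings_whiskered hST hdeg) natr_sum mulr_suml.
  congr EFin; rewrite [RHS]big_mkcond /=; apply: eq_bigr => c _.
  rewrite sum_fiber_card expr1n mulr1; case: ifP => _; last by rewrite !mul0r.
  rewrite mul1r -(big_arc_rank hm _ (fun i => (fiber_card c i)`!)) /=.
  by congr (_%:R / _); apply: eq_bigr => e _; rewrite fiber_card_rank.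
move=> x xm; rewrite flow_region_slice // prod_throughput.
case: ifP => // _; congr EFin; apply: eq_bigr => c _.
rewrite big_ord_recr /= -mulrA; congr (_ * (_ * _)).
  by apply: eq_bigr => i _; rewrite /arc_coord ltn_ord.
by rewrite /arc_coord ltnn (big_nth 0) xm big_mkord.
Qed.
End Volume.

Theorem theorem1p7 (R : realType) (H : sgraph) (S T : {set H})
    (hshores : shores S T)
    (hconnected : connected_graph H)
    (hdeg : forall v : H, (1 < deg v)%N) :
  normalized_volume (flow_polytope R (extension S T))
    (#|matchings (whiskered H)|%:R)%:E.
Proof.
have hdeg0 v : (0 < deg v)%N := ltnW (hdeg v).
have [/card_gt0P[v _] _] := hconnected.
have [e _] := exists_incident hshores hdeg0 v.
(* At least one arc exists, so the arc flows of total 1 form a simplex of dimension one less than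
   the number of arcs. *)
have hm : #|{: darc S T}| = (#|{: darc S T}|.-1).+1.
  by rewrite prednK //; apply/card_gt0P; exists e.
set m := #|_|.-1 in hm.
exists (m + #|H|)%N, (flow_base R S T m), (@flow_dir R H S T m); split.
  exact: (lattice_param_flow R hshores hdeg0 hm).
rewrite (lebesgue_flow_polytope R hshores hdeg0 hm).
by rewrite (volume_flow_region R hshores hdeg0 hm) -EFinM mulrC divfK.
Qed.
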